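(* Let $\alpha = \{ \alpha_g : R_{g^{-1}} \rightarrow R_g \}_{g \in \mathrm{mor}(G)}$ be a unital partial action of a groupoid $G$ on an associative ring $R$. If $\mathrm{mor}(G)$ is finite, $R$ is semisimple, and for every $e\in\mathrm{ob}(G)$ the order $|G_e|$ is invertible in $R$, then the partial skew groupoid ring $R\star_\alpha G$ is semisimple.
   Context: A ring is simple if $\{0\}$ and the ring itself are its only (two-sided) ideals; a ring is semisimple if it is a finite direct sum of simple rings. A groupoid $G$ is a small category in which all morphisms are isomorphisms, with objects $\mathrm{ob}(G)$ identified with identity morphisms, so $\mathrm{ob}(G)\subseteq\mathrm{mor}(G)$; $d(g)$, $c(g)$ are the domain and codomain of $g$, and $G^2$ is the set of pairs $(g,h)$ with $d(g)=c(h)$. For $e\in\mathrm{ob}(G)$, $G_e$ is the group of morphisms with domain and codomain $e$. A partial action of $G$ on $R$ is a family $\alpha = \{ \alpha_g : R_{g^{-1}} \to R_g \}_{g \in \mathrm{mor}(G)}$ such that for each $g$, $R_{c(g)}$ is an ideal of $R$, $R_g$ is an ideal of $R_{c(g)}$, $\alpha_g$ is a ring isomorphism, and: (P1) $\alpha_e=\mathrm{id}_{R_e}$ for $e\in\mathrm{ob}(G)$; (P2) if $(g,h)\in G^2$ then $R_{(gh)^{-1}}\supseteq \alpha_h^{-1}(R_h\cap R_{g^{-1}})$; (P3) if $(g,h)\in G^2$ and $x\in\alpha_h^{-1}(R_h\cap R_{g^{-1}})$ then $\alpha_g(\alpha_h(x))=\alpha_{gh}(x)$; (P4) $R=\bigoplus_{e\in\mathrm{ob}(G)}R_e$.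 It is unital if every non-zero $R_g$ is a unital ring. When $\mathrm{ob}(G)$ is finite, $R$ then has identity $1_R=\sum_e 1_{R_e}$ (with $1_{R_e}=0$ if $R_e=\{0\}$), and a positive integer $m$ is invertible in $R$ if $m1_R$ is. The partial skew groupoid ring $R\star_\alpha G$ is the set of finite formal sums $\sum_{g\in\mathrm{mor}(G)} r_g\delta_g$ with $r_g\in R_g$, with componentwise addition and multiplication determined by $(r_g\delta_g)(r'_h\delta_h)=\alpha_g(\alpha_{g^{-1}}(r_g)r'_h)\delta_{gh}$ if $(g,h)\in G^2$, and $0$ otherwise. *)

(* Defs.v *)
From HB Require Import structures.
From mathcomp Require Import all_boot all_algebra.
From mathcomp Require Import boolp classical_sets functions.

Set Implicit Arguments.
Unset Strict Implicit.
Unset Printing Implicit Defensive.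

Import GRing.Theory.
Local Open Scope ring_scope.
Local Open Scope classical_set_scope.

Reserved Notation "x ** y" (at level 40, left associativity).

(* MathComp's rings are all unital and associative. Here rings are not assumed
   unital: the identity of R is a consequence of the action being unital.
   Associativity is kept as a separate hypothesis on R, so that the skew
   groupoid ring, which need not be associative for an arbitrary partial
   action, is an instance of the same structure. *)
HB.mixin Record isBilinearMagma (V : Type) of GRing.Zmodule V := {
  nmul : V -> V -> V;
  nmulDl : left_distributive nmul +%R;
  nmulDr : right_distributive nmul +%R
}.

#[short(type="naRingType")]
HB.structure Definition NaRing := {V of GRing.Zmodule V & isBilinearMagma V}.

Notation "x ** y" := (nmul x y) : ring_scope.

Section RingNotions.
Variable R : naRingType.
Implicit Types (A J : set R).

(* J is a two-sided ideal of the subring A; the ideals of R itself are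
   those with A = setT. *)
Definition ideal_of A J : Prop :=
  [/\ J `<=` A,
      J 0,
      forall x y, J x -> J y -> J (x - y)
    & forall a x, A a -> J x -> J (a ** x) /\ J (x ** a)].

Definition simple_ring A : Prop :=
  forall J, ideal_of A J -> J = [set 0] \/ J = A.

(* R is the internal direct sum of the subgroups A i, for i satisfying P. *)
Definition direct_sum (I : finType) (P : pred I) (A : I -> set R) : Prop :=
  (forall r : R, exists x : I -> R,
     (forall i, P i -> A i (x i)) /\ r = \sum_(i | P i) x i) /\
  (forall x : I -> R, (forall i, P i -> A i (x i)) ->
     \sum_(i | P i) x i = 0 -> forall i, P i -> x i = 0).

Definition is_identity A (u : R) : Prop :=
  A u /\ forall x, A x -> u ** x = x /\ x ** u = x.

Definition unital_ring A : Prop := exists u, is_identity A u.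

Definition nat_invertible (m : nat) : Prop :=
  exists u v : R,
    [/\ is_identity setT u, (u *+ m) ** v = u & v ** (u *+ m) = u].

Lemma ideal_of_add A J : ideal_of A J ->
  forall x y, J x -> J y -> J (x + y).
Proof.
move=> [_ J0 JB _] x y Jx Jy; rewrite -(opprK y).
by apply: (JB _ _ Jx); rewrite -sub0r; apply: JB.
Qed.

Lemma ideal_of_sum A J (I : finType) (P : pred I) (F : I -> R) :
  ideal_of A J -> (forall i, P i -> J (F i)) -> J (\sum_(i | P i) F i).
Proof.
move=> idJ JF; elim/big_ind: _ => //; first by case: idJ.
exact: ideal_of_add idJ.
Qed.

End RingNotions.

Definition semisimple_ring (R : naRingType) : Prop :=
  exists (n : nat) (A : 'I_n -> set R),
    [/\ forall i, ideal_of setT (A i),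
        forall i, simple_ring (A i)
      & direct_sum xpredT A].

(* A groupoid with finitely many morphisms, given by its morphisms only:
   objects are identified with identity morphisms. The composition gcomp g h
   (first h, then g) is meaningful only when gdom g = gcod h; its other
   values are unconstrained and never used. *)
Record finGroupoid := FinGroupoid {
  mor :> finType;
  gdom : mor -> mor;
  gcod : mor -> mor;
  gcomp : mor -> mor -> mor;
  ginv : mor -> mor;
  gdom_dom : forall g, gdom (gdom g) = gdom g;
  gcod_dom : forall g, gcod (gdom g) = gdom g;
  gdom_cod : forall g, gdom (gcod g) = gcod g;
  gcod_cod : forall g, gcod (gcod g) = gcod g;
  gdom_comp : forall g h, gdom g = gcod h -> gdom (gcomp g h) = gdom h;
  gcod_comp : forall g h, gdom g = gcod h -> gcod (gcomp g h) = gcod g;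
  gcompA : forall g h k, gdom g = gcod h -> gdom h = gcod k ->
    gcomp g (gcomp h k) = gcomp (gcomp g h) k;
  gcomp_dom : forall g, gcomp g (gdom g) = g;
  gcod_gcomp : forall g, gcomp (gcod g) g = g;
  gdom_inv : forall g, gdom (ginv g) = gcod g;
  gcod_inv : forall g, gcod (ginv g) = gdom g;
  gcompV : forall g, gcomp g (ginv g) = gcod g;
  gcompVl : forall g, gcomp (ginv g) g = gdom g
}.

Section GroupoidNotions.
Variable G : finGroupoid.

Definition is_ob (e : G) : bool := gdom e == e.

Definition composable (g h : G) : bool := gdom g == gcod h.

Definition isotropy (e : G) : pred G :=
  [pred g : G | (gdom g == e) && (gcod g == e)].

Lemma ginv_unique (g h : G) :
  gdom g = gcod h -> gcomp g h = gcod g -> h = ginv g.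
Proof.
move=> gh gh1; have cV : gdom (ginv g) = gcod g by rewrite gdom_inv.
rewrite -[LHS]gcod_gcomp -gh -gcompVl -gcompA // gh1 -gdom_inv.
exact: gcomp_dom.
Qed.

Lemma ginvK : involutive (@ginv G).
Proof.
by move=> g; apply/esym/ginv_unique; rewrite ?gdom_inv // gcompVl gcod_inv.
Qed.

Lemma ginv_comp (g h : G) : gdom g = gcod h ->
  ginv (gcomp g h) = gcomp (ginv h) (ginv g).
Proof.
move=> gh.
have hg' : gdom (ginv h) = gcod (ginv g) by rewrite gdom_inv gcod_inv.
apply/esym/ginv_unique.
  by rewrite gdom_comp // gcod_comp // gcod_inv.
rewrite gcod_comp // gcompA ?gdom_comp ?gcod_inv //.
  by rewrite -(gcompA gh) ?gcod_inv // gcompV -gh gcomp_dom gcompV.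
by rewrite gdom_inv gh.
Qed.

Lemma ginv_ob (g : G) : is_ob g -> ginv g = g.
Proof.
move=> /eqP ge; apply/esym/ginv_unique; first by rewrite -{2}ge gcod_dom ge.
by rewrite -{2}ge gcomp_dom -{2}ge gcod_dom ge.
Qed.

End GroupoidNotions.

(* act g is a total function on R, but only its restriction to
   ideal (ginv g) is meaningful. *)
Record partial_action (G : finGroupoid) (R : naRingType) := PartialAction {
  pideal : G -> set R;
  act : G -> R -> R;
  pideal_cod : forall g, ideal_of setT (pideal (gcod g));
  pideal_ideal : forall g, ideal_of (pideal (gcod g)) (pideal g);
  act_bij : forall g, set_bij (pideal (ginv g)) (pideal g) (act g);
  actD : forall g x y, pideal (ginv g) x -> pideal (ginv g) y ->
    act g (x + y) = act g x + act g y;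
  actM : forall g x y, pideal (ginv g) x -> pideal (ginv g) y ->
    act g (x ** y) = act g x ** act g y;
  act_ob : forall e x, is_ob e -> pideal e x -> act e x = x;
  act_sub : forall g h, composable g h ->
    pideal (ginv h) `&` act h @^-1` (pideal h `&` pideal (ginv g))
      `<=` pideal (ginv (gcomp g h));
  act_comp : forall g h x, composable g h ->
    (pideal (ginv h) `&` act h @^-1` (pideal h `&` pideal (ginv g))) x ->
    act g (act h x) = act (gcomp g h) x;
  pideal_sum : direct_sum (@is_ob G) pideal
}.

Definition unital_action (G : finGroupoid) (R : naRingType)
    (alpha : partial_action G R) : Prop :=
  forall g, pideal alpha g <> [set 0] -> unital_ring (pideal alpha g).

Section SkewRing.
Variables (G : finGroupoid) (R : naRingType) (alpha : partial_action G R).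
Local Notation D := (pideal alpha).
Local Notation a := (act alpha).

Lemma pideal0 g : D g 0. Proof. by case: (pideal_ideal alpha g). Qed.

Lemma pidealB g x y : D g x -> D g y -> D g (x - y).
Proof. by case: (pideal_ideal alpha g) => _ _ + _; apply. Qed.

Lemma pidealD g x y : D g x -> D g y -> D g (x + y).
Proof. exact: (ideal_of_add (pideal_ideal alpha g)). Qed.

Lemma act_in g x : D (ginv g) x -> D g (a g x).
Proof. by have [+ _ _] := act_bij alpha g; apply. Qed.

Lemma actV_in g x : D g x -> D (ginv g) (a (ginv g) x).
Proof. by move=> Dx; apply: act_in; rewrite ginvK. Qed.

Lemma act_actV g x : D g x -> a g (a (ginv g) x) = x.
Proof.
move=> Dx; have gV : composable g (ginv g) by rewrite /composable gcod_inv.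
have obg : is_ob (gcod g) by rewrite /is_ob gdom_cod.
rewrite (act_comp gV) ?gcompV ?act_ob //; last first.
  by split=> /=; [rewrite ginvK | split; apply: actV_in].
by have [+ _ _ _] := pideal_ideal alpha g; apply.
Qed.

Lemma act_Vact g x : D (ginv g) x -> a (ginv g) (a g x) = x.
Proof. by move=> /act_actV; rewrite ginvK. Qed.

Lemma skew_term_in g h x y : composable g h -> D g x -> D h y ->
  D (ginv g) (a (ginv g) x ** y) /\
  D (gcomp g h) (a g (a (ginv g) x ** y)).
Proof.
move=> gh Dx Dy.
have [sh _ _ Mh] := pideal_ideal alpha h.
have [sg _ _ Mg] := pideal_ideal alpha (ginv g).
have Ex := actV_in Dx.
have cV : gcod (ginv g) = gcod h by rewrite gcod_inv (eqP gh).
have Dgz : D (ginv g) (a (ginv g) x ** y).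
  by apply: (Mg y _ _ Ex).2; rewrite cV; apply: sh.
have Dhz : D h (a (ginv g) x ** y).
  by apply: (Mh _ y _ Dy).1; rewrite -cV; apply: sg.
split=> //; have hVgV : composable (ginv h) (ginv g).
  by rewrite /composable gdom_inv gcod_inv eq_sym.
have := @act_sub _ _ alpha _ _ hVgV (a g (a (ginv g) x ** y)).
rewrite -ginv_comp ?(eqP gh) // !ginvK; apply; split; first exact: act_in.
by rewrite /= act_Vact.
Qed.

Definition skew_pred : {pred {ffun G -> R}} :=
  fun f => `[< forall g, D g (f g) >].

Lemma skew_predP (f : {ffun G -> R}) :
  reflect (forall g, D g (f g)) (f \in skew_pred).
Proof. exact: asboolP. Qed.

Fact skew_zmod_closed : zmod_closed skew_pred.
Proof.
split=> [|f f' /skew_predP Df /skew_predP Df'].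
  by apply/skew_predP => g; rewrite ffunE; apply: pideal0.
by apply/skew_predP => g; rewrite !ffunE; apply: pidealB.
Qed.
HB.instance Definition _ :=
  GRing.isZmodClosed.Build {ffun G -> R} skew_pred skew_zmod_closed.

(* The formal sum of the r_g delta_g, with r_g in the ideal attached to g, is
   the function g |-> r_g. *)
Record skew_ring := SkewRing {
  skew_val : {ffun G -> R};
  skew_valP : skew_val \in skew_pred
}.

HB.instance Definition _ := [isSub for skew_val].
HB.instance Definition _ := [Choice of skew_ring by <:].
HB.instance Definition _ := [SubChoice_isSubZmodule of skew_ring by <:].

Lemma skew_val_in (u : skew_ring) g : D g (val u g).
Proof. by case: u => f Df; move: g; apply/skew_predP. Qed.

(* The coefficient of delta_k in the biadditive extension of
   (r delta_g)(r' delta_h) = act g (act (ginv g) r ** r') delta_(gcomp g h). *)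
Definition skew_mul_ffun (f f' : {ffun G -> R}) : {ffun G -> R} :=
  [ffun k => \sum_(p : G * G | composable p.1 p.2 && (gcomp p.1 p.2 == k))
     a p.1 (a (ginv p.1) (f p.1) ** f' p.2)].

Lemma skew_mul_subproof (u v : skew_ring) :
  skew_mul_ffun (val u) (val v) \in skew_pred.
Proof.
apply/skew_predP => k; rewrite ffunE; apply: ideal_of_sum.
  exact: pideal_ideal.
move=> [g h] /= /andP[gh /eqP <-].
by apply: (skew_term_in gh _ _).2; apply: skew_val_in.
Qed.

Definition skew_mul (u v : skew_ring) : skew_ring :=
  SkewRing (skew_mul_subproof u v).

Lemma skew_mulDl : left_distributive skew_mul +%R.
Proof.
move=> u u' v; apply: val_inj; apply/ffunP => k.
rewrite raddfD /= !ffunE -big_split; apply: eq_bigr => -[g h] /= /andP[gh _].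
rewrite ffunE actD ?ginvK; try exact: skew_val_in.
by rewrite nmulDl actD //; apply: (skew_term_in gh _ _).1; apply: skew_val_in.
Qed.

Lemma skew_mulDr : right_distributive skew_mul +%R.
Proof.
move=> v u u'; apply: val_inj; apply/ffunP => k.
rewrite raddfD /= !ffunE -big_split; apply: eq_bigr => -[g h] /= /andP[gh _].
rewrite ffunE nmulDr actD //.
all: by apply: (skew_term_in gh _ _).1; apply: skew_val_in.
Qed.

HB.instance Definition _ :=
  isBilinearMagma.Build skew_ring skew_mulDl skew_mulDr.

End SkewRing.

(* Main.v *)
Require Import Defs.
From mathcomp Require Import all_boot all_algebra.
From mathcomp Require Import boolp classical_sets.

(* Cut R into its simple blocks A_i = b_i R. As an R-bimodule the skew groupoid
   ring S is the finite direct sum of the components A_i delta_g, each zero or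
   simple, so every ideal J of S has a sub-bimodule complement, spanned by some
   of these components. A central element eps of R with sum_g act_g(eps) = 1
   plays the role of 1/|G| in Maschke's theorem: it turns the R-linear
   splitting of S into a right identity of J. Once every ideal has a right
   identity, every ideal has an identity, and S splits recursively along
   central idempotents; the number of components in a complement bounds the
   recursion.
   The element eps exists because each g sends the block A_i either to zero or
   onto some block A_j: take eps to be the sum, over one block A_i per orbit,
   of b_i divided by the order of the stabilizer of A_i, which divides the
   order of an isotropy group. *)

Set Implicit Arguments.
Unset Strict Implicit.
Unset Printing Implicit Defensive.

Import GRing.Theory.
Local Open Scope ring_scope.
Local Open Scope classical_set_scope.

(** * Rings without a given identity, and identities of ideals *)

Section NaRingTheory.
Variable R : naRingType.
Implicit Types (x y z u : R) (I J : set R).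

Lemma nmul0r x : 0 ** x = 0.
Proof. by apply: (addrI (0 ** x)); rewrite -nmulDl !addr0. Qed.

Lemma nmulr0 x : x ** 0 = 0.
Proof. by apply: (addrI (x ** 0)); rewrite -nmulDr !addr0. Qed.

Lemma nmulNr x y : (- x) ** y = - (x ** y).
Proof. by apply: (addrI (x ** y)); rewrite -nmulDl !subrr nmul0r. Qed.

Lemma nmulrN x y : x ** (- y) = - (x ** y).
Proof. by apply: (addrI (x ** y)); rewrite -nmulDr !subrr nmulr0. Qed.

Lemma nmulBl x y z : (x - y) ** z = x ** z - y ** z.
Proof. by rewrite nmulDl nmulNr. Qed.

Lemma nmulBr x y z : z ** (x - y) = z ** x - z ** y.
Proof. by rewrite nmulDr nmulrN. Qed.

Lemma nmul_suml (T : Type) (r : seq T) (P : pred T) (F : T -> R) x :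
  (\sum_(i <- r | P i) F i) ** x = \sum_(i <- r | P i) F i ** x.
Proof.
by apply: (big_morph (fun y => y ** x)) => [y z|]; rewrite ?nmulDl ?nmul0r.
Qed.

Lemma nmul_sumr (T : Type) (r : seq T) (P : pred T) (F : T -> R) x :
  x ** (\sum_(i <- r | P i) F i) = \sum_(i <- r | P i) x ** F i.
Proof. by apply: (big_morph (nmul x)) => [y z|]; rewrite ?nmulDr ?nmulr0. Qed.

Lemma nmulMnl x y n : (x *+ n) ** y = (x ** y) *+ n.
Proof. by elim: n => [|n IH]; rewrite ?mulr0n ?nmul0r // !mulrS nmulDl IH. Qed.

Lemma nmulMnr x y n : x ** (y *+ n) = (x ** y) *+ n.
Proof. by elim: n => [|n IH]; rewrite ?mulr0n ?nmulr0 // !mulrS nmulDr IH. Qed.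

Lemma ideal_mull I a x : ideal_of setT I -> I x -> I (a ** x).
Proof. by case=> _ _ _ M Ix; apply: (M a x _ Ix).1. Qed.

Lemma ideal_mulr I a x : ideal_of setT I -> I x -> I (x ** a).
Proof. by case=> _ _ _ M Ix; apply: (M a x _ Ix).2. Qed.

Lemma ideal_sub (A I : set R) x y : ideal_of A I -> I x -> I y -> I (x - y).
Proof. by case=> _ _ B _; apply: B. Qed.

Lemma ideal_opp (A I : set R) x : ideal_of A I -> I x -> I (- x).
Proof. by case=> _ I0 B _ Ix; rewrite -sub0r; apply: B. Qed.

Hypothesis mulA : associative (@nmul R).

(* ux = (ux)u = u(xu) = xu. *)
Lemma identity_comm I u x : ideal_of setT I -> is_identity I u ->
  u ** x = x ** u.
Proof.
move=> idI [Iu uP].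
have [_ uxu] := uP _ (ideal_mulr x idI Iu).
by have [<- _] := uP _ (ideal_mull x idI Iu); rewrite mulA.
Qed.

Lemma identity_memP I u x : ideal_of setT I -> is_identity I u ->
  I x <-> u ** x = x.
Proof.
move=> idI [Iu uP]; split=> [/uP[]//|<-].
exact: ideal_mulr.
Qed.

End NaRingTheory.

(** * Semisimplicity from identities of ideals *)

Section SemisimpleCriterion.
Variables (S : naRingType) (one : S).
Hypothesis mulA : associative (@nmul S).
Hypothesis oneP : is_identity setT one.

(* The elements of I annihilated by I on the left form an ideal of square
   zero; having a right identity, it vanishes. *)
Lemma right_identity_identity :
  (forall I : set S, ideal_of setT I ->
     exists2 e, I e & forall x, I x -> x ** e = x) ->
  forall I : set S, ideal_of setT I -> exists e, is_identity I e.
Proof.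
move=> H I idI; have [e Ie eP] := H I idI.
exists e; split=> // x Ix; split; last exact: eP.
pose N := [set z | I z /\ forall y, I y -> y ** z = 0].
have idN : ideal_of setT N.
  split=> //.
  - by split=> [|y _]; [case: idI | rewrite nmulr0].
  - move=> z w [Iz z0] [Iw w0]; split; first by exact: (ideal_sub idI).
    by move=> y Iy; rewrite nmulBr z0 // w0 // subr0.
  - move=> a z _ [Iz z0]; split; split.
    + exact: ideal_mull.
    + by move=> y Iy; rewrite mulA z0 //; apply: ideal_mulr.
    + exact: ideal_mulr.
    + by move=> y Iy; rewrite mulA z0 // nmul0r.
have [f [_ f0] fP] := H N idN.
have N0 z : N z -> z = 0 by move=> Nz; rewrite -(fP z Nz) f0 //; case: Nz.
(* The difference [x - e ** x] lies in [N], because [y ** e = y] for [y] in [I]. *)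
apply/eqP; rewrite -subr_eq0; apply/eqP/N0; split.
  by apply: (ideal_sub idI _ Ix); exact: ideal_mull.
by move=> y Iy; rewrite nmulBr mulA eP // subrr.
Qed.

Section Decomposition.
(** A relation rather than a function: an ideal may have several lengths, one for each choice of a
    complement. *)
Variable len : set S -> nat -> Prop.
Hypothesis ideal_identity :
  forall I : set S, ideal_of setT I -> exists e, is_identity I e.
Hypothesis len_lt : forall (I J : set S) n,
  ideal_of setT I -> ideal_of setT J -> I `<=` J -> I <> J ->
  len J n -> exists2 m, (m < n)%N & len I m.

Let orth (x y : S) := (x ** y == 0) && (y ** x == 0).

(** The identity [f] of [J] absorbs outside factors: [a ** x = (a ** f) ** x], and [a ** f] lies in
    [J]. *)
Lemma ideal_trans (J L : set S) f : ideal_of setT J -> is_identity J f ->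
  ideal_of J L -> ideal_of setT L.
Proof.
move=> idJ idf [LJ L0 LB LM]; split=> // a x _ Lx.
have Jf := idf.1; have [fx xf] := idf.2 x (LJ x Lx).
split.
  by rewrite -fx mulA; apply: (LM _ x _ Lx).1; apply: ideal_mull.
by rewrite -xf -mulA; apply: (LM _ x _ Lx).2; apply: ideal_mulr.
Qed.

(** If [J] is not simple, a proper non-zero ideal [L] with identity [e] splits off. The annihilator
    [L'] of [e] in [J] has identity [f - e]; both are shorter than [J], and their decompositions are
    concatenated. *)
Lemma orthogonal_decomposition n (J : set S) f :
  ideal_of setT J -> is_identity J f -> len J n ->
  exists s : seq S, [/\ \sum_(x <- s) x = f, pairwise orth s
    & forall x, x \in s -> exists A : set S,
        [/\ ideal_of setT A, A `<=` J, is_identity A x & simple_ring A]].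
Proof.
elim/ltn_ind: n J f => n IH J f idJ idf lenJ.
have [sJ|/existsNP[L /not_implyP[LidJ /not_orP[Ln0 LnJ]]]] :=
    pselect (simple_ring J).
  exists [:: f]; split; rewrite ?big_seq1 // => x; rewrite inE => /eqP->.
  by exists J; split=> // y.
have LJ : L `<=` J by case: LidJ.
have idL : ideal_of setT L by exact: (ideal_trans idJ idf).
have [e ide] := ideal_identity idL.
have eC x : e ** x = x ** e by apply: (identity_comm mulA x idL ide).
pose L' := [set x | J x /\ e ** x = 0].
have L'J : L' `<=` J by move=> x [].
have idL' : ideal_of setT L'.
  split=> //.
  - by split; [case: idJ | rewrite nmulr0].
  - move=> x y [Jx ex] [Jy ey]; split; last by rewrite nmulBr ex ey subr0.
    exact: (ideal_sub idJ).
  - move=> a x _ [Jx ex]; split; split.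
    + exact: ideal_mull.
    + by rewrite mulA eC -mulA ex nmulr0.
    + exact: ideal_mulr.
    + by rewrite mulA ex nmul0r.
have Je := LJ e ide.1.
have ee : e ** e = e by have [] := ide.2 e ide.1.
(* Otherwise [e] annihilates itself, so [e = 0] and [L] is zero. *)
have L'nJ : L' <> J.
  move=> L'J_; apply: Ln0; apply/seteqP; split=> x /= => [Lx|->]; last first.
    by case: LidJ.
  have [_ e0] : L' e by rewrite L'J_.
  by have [<- _] := ide.2 x Lx; rewrite -ee e0 nmul0r.
have ide' : is_identity L' (f - e).
  split.
    split; first exact: (ideal_sub idJ idf.1 Je).
    by rewrite nmulBr ee; have [_ ->] := idf.2 e Je; rewrite subrr.
  move=> x [Jx ex]; have [fx xf] := idf.2 x Jx.
  by rewrite nmulBl nmulBr fx xf -eC ex subr0.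
have [m mn lenL] := len_lt idL idJ LJ LnJ lenJ.
have [m' mn' lenL'] := len_lt idL' idJ L'J L'nJ lenJ.
have [s [sums ps Ps]] := IH m mn L e idL ide lenL.
have [s' [sums' ps' Ps']] := IH m' mn' L' (f - e) idL' ide' lenL'.
exists (s ++ s'); split.
- by rewrite big_cat /= sums sums' addrC subrK.
- rewrite pairwise_cat ps ps' /= andbT; apply/allrelP => x y xs ys'.
  have [A [_ AL idx _]] := Ps x xs; have [A' [_ AL' idy _]] := Ps' y ys'.
  have [ex xe] := ide.2 x (AL x idx.1); have [_ ey] := AL' y idy.1.
  by rewrite /orth -{1}xe -mulA ey nmulr0 -ex mulA -eC ey nmul0r eqxx.
- move=> x; rewrite mem_cat => /orP[/Ps|/Ps'] [A [idA AL idx sA]].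
    by exists A; split=> // y /AL /LJ.
  by exists A; split=> // y /AL /L'J.
Qed.

Lemma semisimple_of_length n : len setT n -> semisimple_ring S.
Proof.
move=> lenS.
have idS : ideal_of (setT : set S) setT by split.
have [s [sums /(pairwiseP 0) ps Ps]] := orthogonal_decomposition idS oneP lenS.
have orths (i j : 'I_(size s)) : i != j -> s`_i ** s`_j = 0.
  move=> nij; have /orP[ij|ji] : (i < j)%N || (j < i)%N by rewrite -neq_ltn.
    by have /andP[/eqP] := ps _ _ (ltn_ord i) (ltn_ord j) ij.
  by have /andP[_ /eqP] := ps _ _ (ltn_ord j) (ltn_ord i) ji.
(* Described by its idempotent, each ideal depends on the index without any choice. *)
pose A (i : 'I_(size s)) := [set x | s`_i ** x = x].
have AP i : [/\ ideal_of setT (A i) & simple_ring (A i)].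
  have [B [idB _ idx sB]] := Ps s`_i (mem_nth 0 (ltn_ord i)).
  suff -> : A i = B by [].
  by apply/seteqP; split=> x /(identity_memP x idB idx).
exists (size s), A; split=> [i|i|]; [by case: (AP i)..|].
split=> [r|x Ax sumx j _].
  exists (fun i : 'I_(size s) => s`_i ** r); split.
    move=> i _; have [B [_ _ idx _]] := Ps s`_i (mem_nth 0 (ltn_ord i)).
    by rewrite /A /= mulA; have [-> _] := idx.2 _ idx.1.
  rewrite -nmul_suml; have <- : one = \sum_(i < size s) s`_i.
    by rewrite -sums (big_nth 0) big_mkord.
  by have [->] := oneP.2 r I.
(* Multiplication by the idempotent of index [j] isolates the summand [x j]. *)
have := congr1 (nmul s`_j) sumx.
rewrite nmul_sumr nmulr0 (bigD1 j) //= big1 => [|i ij].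
  by rewrite addr0 => <-; rewrite [in RHS](Ax j).
by rewrite -(Ax i isT) mulA orths ?nmul0r // eq_sym.
Qed.
End Decomposition.
End SemisimpleCriterion.

(** The simple summands are encoded by central orthogonal idempotents. Some [b i] may be zero, since
    the zero ring counts as simple. *)
Definition is_blocks (R : naRingType) (one : R) n (b : 'I_n -> R) : Prop :=
  [/\ \sum_i b i = one, forall i r, b i ** r = r ** b i,
      forall i j, b i ** b j = if i == j then b i else 0
    & forall i J, ideal_of [set r | b i ** r = r] J ->
        J = [set 0] \/ J = [set r | b i ** r = r]].

(** * Unital partial actions and their extension by zero *)

Section UnitalAction.
Variables (R : naRingType) (G : finGroupoid) (alpha : partial_action G R).
Hypothesis mulA : associative (@nmul R).
Hypothesis unital : unital_action alpha.
Local Notation D := (pideal alpha).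
Local Notation a := (act alpha).
Implicit Types (g h k e : G) (r s x y : R).

(** The identity of the ideal at [g]; it exists for every [g], as the zero ideal has identity 0. *)
Definition gone g : R := xget 0 [set v | is_identity (D g) v].

Lemma goneP g : is_identity (D g) (gone g).
Proof.
suff [v vP] : unital_ring (D g) by apply: xgetPex; exists v.
have [Dg0|/unital//] := pselect (D g = [set 0]).
by exists 0; rewrite Dg0; split=> // x ->; rewrite nmul0r.
Qed.

Lemma gone_in g : D g (gone g). Proof. exact: (goneP g).1. Qed.

(** Factors from R are first absorbed into the ideal at [gcod g] by means of its identity. *)
Lemma pideal_ideal_of_ring g : ideal_of setT (D g).
Proof.
have [DgD D0 DB DM] := pideal_ideal alpha g.
have idc := pideal_cod alpha g.
split=> // r x _ Dx; have [cx xc] := (goneP (gcod g)).2 x (DgD x Dx).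
split.
  rewrite -cx mulA; apply: (DM _ x _ Dx).1.
  exact: ideal_mull idc (gone_in _).
rewrite -xc -mulA; apply: (DM _ x _ Dx).2.
exact: ideal_mulr idc (gone_in _).
Qed.

Lemma gone_comm g r : gone g ** r = r ** gone g.
Proof. exact: (identity_comm mulA r (pideal_ideal_of_ring g) (goneP g)). Qed.

Lemma pidealE g r : D g r <-> gone g ** r = r.
Proof. exact: (identity_memP r (pideal_ideal_of_ring g) (goneP g)). Qed.

Lemma gone_mul g r : D g r -> gone g ** r = r. Proof. by move/pidealE. Qed.

Lemma mul_gone g r : D g r -> r ** gone g = r.
Proof. by rewrite -gone_comm; apply: gone_mul. Qed.

Lemma gone_idem g : gone g ** gone g = gone g.
Proof. exact/gone_mul/gone_in. Qed.

Lemma gone_mul_in g r : D g (gone g ** r).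
Proof. exact: ideal_mulr (pideal_ideal_of_ring g) (gone_in g). Qed.

Lemma mul_gone_in g r : D g (r ** gone g).
Proof. exact: ideal_mull (pideal_ideal_of_ring g) (gone_in g). Qed.

Lemma pideal_codW g r : D g r -> D (gcod g) r.
Proof. by case: (pideal_ideal alpha g) => + _ _ _; apply. Qed.

Lemma is_ob_cod g : is_ob (gcod g).
Proof. by rewrite /is_ob gdom_cod. Qed.

Lemma is_ob_dom g : is_ob (gdom g).
Proof. by rewrite /is_ob gdom_dom. Qed.

Lemma ob_cod e : is_ob e -> gcod e = e.
Proof. by move=> /eqP <-; rewrite gcod_dom. Qed.

(** Putting [r] at [e] and [- r] at [e'] gives a decomposition of 0. *)
Lemma pideal_ob_disjoint e e' r : is_ob e -> is_ob e' -> e != e' ->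
  D e r -> D e' r -> r = 0.
Proof.
move=> obe obe' ne De De'; have [_ uniq] := pideal_sum alpha.
pose x i := if i == e then r else if i == e' then - r else 0.
have Dx i : is_ob i -> D i (x i).
  rewrite /x; case: eqP => [->//|_ _]; case: eqP => [->|_].
    exact: ideal_opp (pideal_ideal_of_ring e') De'.
  exact: pideal0.
have := uniq x Dx _ e obe; rewrite /x eqxx; apply.
rewrite (bigD1 e) // (bigD1 e') /=; last by rewrite obe' eq_sym.
rewrite !eqxx [e' == e]eq_sym (negPf ne) big1 ?addr0 ?subrr // => i.
by move=> /andP[/andP[_ /negPf ->] /negPf ->].
Qed.

Lemma pideal_disjoint g h r : gcod g != gcod h -> D g r -> D h r -> r = 0.
Proof.
move=> ne /pideal_codW Dg /pideal_codW Dh.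
exact: pideal_ob_disjoint (is_ob_cod g) (is_ob_cod h) ne Dg Dh.
Qed.

Definition rone : R := \sum_(e | is_ob e) gone e.

Lemma roneP : is_identity setT rone.
Proof.
have [decomp _] := pideal_sum alpha.
have gx (x : G -> R) e : (forall e, is_ob e -> D e (x e)) -> is_ob e ->
    gone e ** (\sum_(e' | is_ob e') x e') = x e.
  move=> Dx obe; rewrite nmul_sumr (bigD1 e) //= gone_mul; last exact: Dx.
  rewrite big1 ?addr0 // => e' /andP[obe' ne].
  apply: (pideal_ob_disjoint obe obe'); first by rewrite eq_sym.
    exact: gone_mul_in.
  exact: ideal_mull (pideal_ideal_of_ring _) (Dx _ obe').
split=> // r _; have [x [Dx ->]] := decomp r.
have roneE : rone ** (\sum_(e | is_ob e) x e) = \sum_(e | is_ob e) x e.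
  by rewrite nmul_suml; apply: eq_bigr => e obe; rewrite gx.
split=> //; rewrite -[RHS]roneE; move: (\sum_(e | _) x e) => s.
rewrite nmul_suml nmul_sumr.
by apply: eq_bigr => e _; rewrite gone_comm.
Qed.

Lemma rone_mul r : rone ** r = r. Proof. by have [] := roneP.2 r I. Qed.
Lemma mul_rone r : r ** rone = r. Proof. by have [] := roneP.2 r I. Qed.

(* The partial map act g extended by zero to an endomorphism of R. *)
Definition gact g r : R := a g (gone (ginv g) ** r).

Lemma gact_in g r : D g (gact g r).
Proof. by apply: act_in; apply: gone_mul_in. Qed.

Lemma gactE g r : D (ginv g) r -> gact g r = a g r.
Proof. by move=> Dr; rewrite /gact gone_mul. Qed.

Lemma gactD g r s : gact g (r + s) = gact g r + gact g s.
Proof. by rewrite /gact nmulDr actD //; apply: gone_mul_in. Qed.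

Lemma gact0 g : gact g 0 = 0.
Proof. by apply: (addrI (gact g 0)); rewrite -gactD !addr0. Qed.

Lemma gactMn g r n : gact g (r *+ n) = gact g r *+ n.
Proof. by elim: n => [|n IH]; rewrite ?mulr0n ?gact0 // !mulrS gactD IH. Qed.

Lemma gact_sum g (T : Type) (q : seq T) (P : pred T) (F : T -> R) :
  gact g (\sum_(i <- q | P i) F i) = \sum_(i <- q | P i) gact g (F i).
Proof. exact: (big_morph _ (gactD g) (gact0 g)). Qed.

Lemma gactM g r s : gact g (r ** s) = gact g r ** gact g s.
Proof.
rewrite /gact -actM; try exact: gone_mul_in.
by rewrite -mulA (mulA r) -gone_comm !mulA gone_idem.
Qed.

Lemma gone_gact g r : gone g ** gact g r = gact g r.
Proof. exact/gone_mul/gact_in. Qed.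

Lemma gact_gone g r : gact g r ** gone g = gact g r.
Proof. exact/mul_gone/gact_in. Qed.

Lemma gactV_in g r : D g r -> gact g (gact (ginv g) r) = r.
Proof.
move=> Dr; rewrite (gactE (g := ginv g)) ?ginvK // gactE ?act_actV //.
exact: actV_in.
Qed.

Lemma gact_rone g : gact g rone = gone g.
Proof.
by rewrite -[LHS]gact_gone -{1}(gactV_in (gone_in g)) -gactM rone_mul gactV_in
  //; apply: gone_in.
Qed.

Lemma gact_gone_mul g r : gact g (gone (ginv g) ** r) = gact g r.
Proof. by rewrite /gact mulA gone_idem. Qed.

(** The two composition axioms, restated for the image [r] under [h] instead of its preimage. *)
Lemma gact_comp_in g h r : composable g h -> D h r -> D (ginv g) r ->
  D (ginv (gcomp g h)) (gact (ginv h) r) /\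
  gact (gcomp g h) (gact (ginv h) r) = gact g r.
Proof.
move=> gh Dh Dg.
have dom : (D (ginv h) `&` a h @^-1` (D h `&` D (ginv g))) (gact (ginv h) r).
  split; first exact: gact_in.
  by rewrite /= -gactE ?gactV_in //; exact: gact_in.
have Dgh := act_sub gh dom; split=> //.
rewrite gactE // -(act_comp gh dom) -gactE; last exact: dom.2.2.
by rewrite -gactE ?gactV_in //; exact: gact_in.
Qed.

Lemma composableV g h : composable g h -> composable (ginv g) (gcomp g h).
Proof. by move=> /eqP gh; rewrite /composable gdom_inv gcod_comp. Qed.

Lemma gcompKV g h : composable g h -> gcomp (ginv g) (gcomp g h) = h.
Proof.
move=> /eqP gh; rewrite gcompA ?gdom_inv // gcompVl gh.
exact: gcod_gcomp.
Qed.

(** The image of [gone h] lies in the ideal at [gcomp g h]. Conversely, the preimage of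
    [gone g ** gone (gcomp g h)] lies in the ideal at [h], so multiplying it by [gone h] changes
    nothing. *)
Lemma gact_gone_comp g h : composable g h ->
  gact g (gone h) = gone g ** gone (gcomp g h).
Proof.
move=> gh; set f := gcomp g h; apply/esym.
have Dw : D h (gact (ginv g) (gone g ** gone f)).
  have c : composable (ginv f) g.
    by rewrite /composable gdom_inv /f gcod_comp //; apply/eqP.
  have [] := @gact_comp_in (ginv f) g (gone g ** gone f) c.
  - exact: gone_mul_in.
  - by rewrite ginvK; apply: mul_gone_in.
  have -> : gcomp (ginv f) g = ginv h.
    have := gcompKV (composableV gh); rewrite ginvK => E.
    rewrite -[LHS]ginvK ginv_comp ?ginvK; last exact/eqP.
    by rewrite gcompKV.
  by rewrite ginvK.
have Dgh : D f (gact g (gone h)).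
  rewrite -gact_gone_mul.
  have [_ <-] := @gact_comp_in g h (gone (ginv g) ** gone h) gh
    (mul_gone_in _ _) (gone_mul_in _ _).
  exact: gact_in.
rewrite -[LHS](gactV_in (gone_mul_in _ _)) -[X in gact g X](gone_mul Dw).
rewrite gactM (gactV_in (gone_mul_in _ _)) mulA gact_gone.
by rewrite mul_gone.
Qed.

Lemma gactK g r : gact (ginv g) (gact g r) = gone (ginv g) ** r.
Proof.
by have := gactV_in (gone_mul_in (ginv g) r); rewrite ginvK gact_gone_mul.
Qed.

(** Extensions by zero compose only up to the idempotent [gone g]. The element
    [gone (ginv g) ** gact h r] lies where the partial maps do compose, and [gact_gone_comp] carries
    the remaining idempotents across. *)
Lemma gact_comp g h r : composable g h ->
  gact g (gact h r) = gone g ** gact (gcomp g h) r.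
Proof.
move=> gh; set f := gcomp g h.
have hVgV : composable (ginv h) (ginv g).
  by rewrite /composable gdom_inv gcod_inv eq_sym.
have fhV : composable f (ginv h).
  by rewrite /composable gcod_inv /f gdom_comp //; apply/eqP.
have fhVE : gcomp f (ginv h) = g.
  have /eqP E := gh; rewrite -gcompA ?gcod_inv // gcompV -E; exact: gcomp_dom.
have := (@gact_comp_in g h (gone (ginv g) ** gact h r) gh
  (ideal_mull _ (pideal_ideal_of_ring h) (gact_in _ _)) (gone_mul_in _ _)).2.
rewrite gact_gone_mul -/f => <-; rewrite gactM gactK gact_gone_comp //.
rewrite -ginv_comp -/f; last exact/eqP.
rewrite -mulA gactM gact_gone_mul gactM gact_gone_comp // fhVE.
rewrite (gone_comm f (gone g)) -!mulA gone_gact (mulA (gone f)).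
by rewrite (gone_comm f (gone g)) -mulA gone_gact mulA gone_idem.
Qed.

Lemma gact_comp0 g h r : ~~ composable g h -> gact g (gact h r) = 0.
Proof.
move=> ngh; rewrite /gact -/(gact h r).
suff -> : gone (ginv g) ** gact h r = 0.
  by have := gact0 g; rewrite /gact nmulr0.
apply: (@pideal_disjoint (ginv g) h); first by rewrite gcod_inv.
  exact: gone_mul_in.
exact: ideal_mull (pideal_ideal_of_ring h) (gact_in _ _).
Qed.

Lemma gact_ob e r : is_ob e -> gact e r = gone e ** r.
Proof.
by move=> obe; rewrite /gact ginv_ob // act_ob //; apply: gone_mul_in.
Qed.

Lemma gone_cod g : gone (gcod g) ** gone g = gone g.
Proof. exact/gone_mul/pideal_codW/gone_in. Qed.

Lemma gone_ob_disjoint e g : is_ob e -> gcod g != e -> gone e ** gone g = 0.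
Proof.
move=> obe ne; apply: (@pideal_disjoint e g); first by rewrite ob_cod // eq_sym.
  exact: gone_mul_in.
exact: mul_gone_in.
Qed.

Lemma gactKV g r : gact g (gact (ginv g) r) = gone g ** r.
Proof. by have := gactK (ginv g) r; rewrite ginvK. Qed.

(** * Monomials of the skew groupoid ring, and associativity *)

Local Notation S := (skew_ring alpha).
Implicit Types (X Y Z : S).

Fact mono_subproof g r :
  [ffun k => if k == g then gone g ** r else 0] \in skew_pred alpha.
Proof.
apply/skew_predP => k; rewrite ffunE; case: eqP => [->|_].
  exact: gone_mul_in.
exact: pideal0.
Qed.

(** Cutting the coefficient down by [gone g] makes [mono g] an additive map on all of R. *)
Definition mono g r : S := SkewRing (mono_subproof g r).

Lemma val_mono g r k : val (mono g r) k = if k == g then gone g ** r else 0.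
Proof. by rewrite ffunE. Qed.

Lemma skewP X Y : (forall g, val X g = val Y g) -> X = Y.
Proof. by move=> E; apply/val_inj/ffunP. Qed.

Lemma val_add X Y g : val (X + Y) g = val X g + val Y g.
Proof. by rewrite raddfD /= ffunE. Qed.

Lemma val_sub X Y g : val (X - Y) g = val X g - val Y g.
Proof. by rewrite raddfB /= !ffunE. Qed.

Lemma val_0 g : val (0 : S) g = 0.
Proof. by rewrite raddf0 ffunE. Qed.

Lemma val_sum (T : Type) (q : seq T) (P : pred T) (F : T -> S) g :
  val (\sum_(i <- q | P i) F i) g = \sum_(i <- q | P i) val (F i) g.
Proof.
by apply: (big_morph (fun X => val X g)) => [X Y|]; rewrite ?val_add ?val_0.
Qed.

Lemma monoD g r s : mono g (r + s) = mono g r + mono g s.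
Proof.
apply: skewP => k; rewrite val_add !val_mono.
by case: eqP; rewrite ?nmulDr ?addr0.
Qed.

Lemma mono0 g : mono g 0 = 0.
Proof. by apply: (addrI (mono g 0)); rewrite -monoD !addr0. Qed.

Lemma monoB g r s : mono g (r - s) = mono g r - mono g s.
Proof. by apply: (addIr (mono g s)); rewrite -monoD !subrK. Qed.

Lemma mono_sum g (T : Type) (q : seq T) (P : pred T) (F : T -> R) :
  mono g (\sum_(i <- q | P i) F i) = \sum_(i <- q | P i) mono g (F i).
Proof. exact: (big_morph _ (monoD g) (mono0 g)). Qed.

Lemma mono_gone g r : mono g (gone g ** r) = mono g r.
Proof. by apply: skewP => k; rewrite !val_mono mulA gone_idem. Qed.

Lemma mono_eq0 g r : gone g ** r = 0 -> mono g r = 0.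
Proof. by move=> r0; rewrite -mono_gone r0 mono0. Qed.

Lemma skew_mono X : X = \sum_g mono g (val X g).
Proof.
apply: skewP => k; rewrite val_sum (bigD1 k) //= val_mono eqxx gone_mul.
  rewrite big1 ?addr0 // => g gk.
  by rewrite val_mono eq_sym (negPf gk).
exact: skew_val_in.
Qed.

(** Applying [gact g] to the product in the definition cancels [gact (ginv g)] on the left factor,
    which leaves [r ** gact g s]. *)
Lemma mono_mul g h r s : mono g r ** mono h s =
  if composable g h then mono (gcomp g h) (r ** gact g s) else 0.
Proof.
have coef : composable g h ->
    a g (a (ginv g) (gone g ** r) ** (gone h ** s)) =
    gone (gcomp g h) ** (r ** gact g s).
  move=> gh; rewrite -gactE; last first.
    by apply: ideal_mulr (pideal_ideal_of_ring _) _; apply/actV_in/gone_mul_in.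
  rewrite gactM -(gactE (g := ginv g)); last first.
    by rewrite ginvK; apply: gone_mul_in.
  rewrite gactV_in; last exact: gone_mul_in.
  rewrite gactM gact_gone_comp // -!mulA gone_comm.
  rewrite [gone (gcomp g h) ** gact g s]gone_comm (mulA (gone g)) gone_gact.
  rewrite mulA -mulA (gone_comm (gcomp g h) (gone g)) mulA -(mulA r) gact_gone.
  by rewrite gone_comm.
apply: skewP => k; rewrite ffunE.
(* Only the pair [(g, h)] contributes to the convolution sum. *)
have term (p : G * G) : p != (g, h) ->
    a p.1 (a (ginv p.1) (val (mono g r) p.1) ** val (mono h s) p.2) = 0.
  case: p => g' h' /= ne; rewrite !val_mono.
  have act0 f : a f 0 = 0 by have := gact0 f; rewrite /gact nmulr0.
  have [g'g|_] := eqVneq g' g; last by rewrite act0 nmul0r act0.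
  have [h'h|_] := eqVneq h' h; last by rewrite nmulr0 act0.
  by rewrite g'g h'h eqxx in ne.
have [gh|ngh] := boolP (composable g h); last first.
  rewrite big1 ?val_0 // => p /andP[pc _]; apply: term.
  by apply: contraNneq ngh => E; move: pc; rewrite E.
rewrite val_mono; case: eqP => [->|ne].
  rewrite (bigD1 (g, h)) /=; last by rewrite gh eqxx.
  rewrite !val_mono !eqxx coef // big1 ?addr0 // => p /andP[_].
  exact: term.
rewrite big1 // => p /andP[_ /eqP pk]; apply: term.
by apply: contra_not_neq ne => E; rewrite -pk E.
Qed.

(** On monomials, the idempotent [gone g] left over by [gact_comp] is absorbed by [gact g s]. *)
Lemma skew_mulA : associative (@nmul S).
Proof.
move=> X Y Z; rewrite (skew_mono X) !nmul_suml; apply: eq_bigr => g _.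
rewrite (skew_mono Y) !nmul_sumr !nmul_suml nmul_sumr; apply: eq_bigr => h _.
rewrite (skew_mono Z) !nmul_sumr; apply: eq_bigr => k _.
move: (val X g) (val Y h) (val Z k) => r s t.
rewrite !mono_mul; case hk: (composable h k); case gh: (composable g h).
- have /eqP hk' := hk; have /eqP gh' := gh.
  rewrite !mono_mul /composable gcod_comp // gdom_comp // gh' hk' !eqxx.
  rewrite -gcompA // gactM gact_comp // -!mulA.
  by rewrite (mulA (gact g s)) gact_gone.
- rewrite nmul0r mono_mul /composable gcod_comp ?ifF //.
  exact/eqP.
- rewrite nmulr0 mono_mul /composable gdom_comp ?ifF //.
  exact/eqP.
- by rewrite nmul0r nmulr0.
Qed.

(** * The R-bimodule structure of the skew groupoid ring *)

(** The canonical embedding of R; multiplication by its image makes S an R-bimodule. *)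
Definition diag r : S := \sum_(e | is_ob e) mono e r.

Lemma diag_sum (T : Type) (q : seq T) (P : pred T) (F : T -> R) :
  diag (\sum_(i <- q | P i) F i) = \sum_(i <- q | P i) diag (F i).
Proof.
by rewrite /diag exchange_big; apply: eq_bigr => e _; rewrite mono_sum.
Qed.

Lemma diag_mono r g s : diag r ** mono g s = mono g (r ** s).
Proof.
rewrite nmul_suml (bigD1 (gcod g)) /= ?is_ob_cod // mono_mul.
rewrite /composable gdom_cod eqxx gcod_gcomp gact_ob ?is_ob_cod //.
rewrite big1 ?addr0 => [|e /andP[/eqP ede ne]]; last first.
  by rewrite mono_mul /composable ede (negPf ne).
rewrite -mono_gone -[RHS]mono_gone !mulA -(mulA _ r) -(gone_comm (gcod g) r).
by rewrite (mulA (gone g)) (gone_comm g) gone_cod.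
Qed.

Lemma mono_diag r g s : mono g s ** diag r = mono g (s ** gact g r).
Proof.
rewrite nmul_sumr (bigD1 (gdom g)) /= ?is_ob_dom // mono_mul.
rewrite /composable gcod_dom eqxx gcomp_dom big1 ?addr0 // => e /andP[obe ne].
by rewrite mono_mul /composable ob_cod // eq_sym (negPf ne).
Qed.

Lemma skew_oneP : is_identity setT (diag rone).
Proof.
split=> // X _; rewrite (skew_mono X) nmul_sumr nmul_suml.
split; apply: eq_bigr => g _; first by rewrite diag_mono rone_mul.
by rewrite mono_diag gact_rone -gone_comm mono_gone.
Qed.

(** Opposites come from multiplication by [diag (- rone)]. *)
Definition sub_bimodule (N : set S) : Prop :=
  [/\ N 0, forall X Y, N X -> N Y -> N (X + Y)
    & forall r X, N X -> N (diag r ** X) /\ N (X ** diag r)].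

Lemma sub_bimodule_sum (N : set S) (T : Type) (q : seq T) (P : pred T)
    (F : T -> S) :
  sub_bimodule N -> (forall i, P i -> N (F i)) -> N (\sum_(i <- q | P i) F i).
Proof. by case=> N0 ND _ NF; elim/big_ind: _. Qed.

Lemma ideal_sub_bimodule (J : set S) : ideal_of setT J -> sub_bimodule J.
Proof.
move=> idJ; split; first by case: idJ.
  exact: ideal_of_add idJ.
by move=> r X JX; split; [apply: ideal_mull | apply: ideal_mulr].
Qed.

Lemma val_diagl r X g : val (diag r ** X) g = r ** val X g.
Proof.
rewrite {1}(skew_mono X) nmul_sumr val_sum (bigD1 g) // diag_mono val_mono eqxx.
rewrite gone_comm -mulA mul_gone; last exact: skew_val_in.
rewrite big1 => [|h /andP[_ hg]]; first exact: addr0.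
by rewrite diag_mono val_mono eq_sym (negPf hg).
Qed.

Lemma val_diagr r X g : val (X ** diag r) g = val X g ** gact g r.
Proof.
rewrite {1}(skew_mono X) nmul_suml val_sum (bigD1 g) // mono_diag val_mono eqxx.
rewrite mulA gone_mul; last exact: skew_val_in.
rewrite big1 => [|h /andP[_ hg]]; first exact: addr0.
by rewrite mono_diag val_mono eq_sym (negPf hg).
Qed.

Lemma sub_bimoduleN (N : set S) X : sub_bimodule N -> N X -> N (- X).
Proof.
case=> _ _ NM NX; have := (NM (- rone) X NX).1.
suff -> : diag (- rone) ** X = - X by [].
by apply: skewP => g; rewrite val_diagl nmulNr rone_mul raddfN /= ffunE.
Qed.

(** * Averaging over the groupoid *)

Section Averaging.
Variable eps : R.
Hypothesis epsC : forall r, eps ** r = r ** eps.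
Hypothesis eps_trace : \sum_g gact g eps = rone.

Let t g : S := mono (ginv g) eps.

(** The term at [g] is [gact g eps] placed at the object [gcod g]. It equals [diag (gact g eps)],
    since the other objects annihilate [gact g eps]. *)
Lemma trace_sum : \sum_g mono g rone ** t g = diag rone.
Proof.
rewrite -[in RHS]eps_trace diag_sum; apply: eq_bigr => g _.
rewrite mono_mul /composable gcod_inv eqxx gcompV rone_mul /diag.
rewrite (bigD1 (gcod g)) ?is_ob_cod //= big1 ?addr0 // => e /andP[obe ne].
apply: mono_eq0; rewrite -gone_gact mulA gone_ob_disjoint ?nmul0r //.
by rewrite eq_sym.
Qed.

(* Writing t g = p g + q g along a bimodule decomposition S = J + M, the sum
   of the (mono g 1) (p g) is a right identity of J: the translates of the
   t g under right multiplication by S are R-linear combinations of the t g,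
   with matching coefficients on the left factors. *)
Lemma right_identity_of_complement (J M : set S) :
  ideal_of setT J -> sub_bimodule M ->
  (forall X, J X -> M X -> X = 0) ->
  (forall X, exists Y Z, [/\ J Y, M Z & X = Y + Z]) ->
  exists2 e, J e & forall X, J X -> X ** e = X.
Proof.
move=> idJ bM JM0 JM; have bJ := ideal_sub_bimodule idJ.
have [p /choice[q pq]] := choice (fun g => JM (t g)).
exists (\sum_g mono g rone ** p g).
  apply: sub_bimodule_sum bJ _ => g _.
  by apply: ideal_mull => //; case: (pq g).
move=> X JX.
pose c k h := gact (ginv k) (val X h).
have tX k : t k ** X =
    \sum_(h | gcod h == gcod k) diag (c k h) ** t (gcomp (ginv h) k).
  rewrite {1}(skew_mono X) nmul_sumr [RHS]big_mkcond /=.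
  apply: eq_bigr => h _; rewrite mono_mul /composable gdom_inv eq_sym.
  case: eqP => // hk; rewrite diag_mono epsC ginv_comp ?ginvK //.
  by rewrite gdom_inv.
(* Both sides lie in [J]; by [tX] their difference is an R-combination of the [q g], hence lies in
   [M] too and vanishes. *)
have pX k : t k ** X =
    \sum_(h | gcod h == gcod k) diag (c k h) ** p (gcomp (ginv h) k).
  have [_ _ bMM] := bM; have [_ _ bJM] := bJ.
  apply/eqP; rewrite -subr_eq0; apply/eqP/JM0.
    apply: (ideal_sub idJ); first exact: ideal_mull.
    apply: sub_bimodule_sum bJ _ => h _; apply: (bJM _ _ _).1.
    by case: (pq (gcomp (ginv h) k)).
  rewrite tX -sumrB; apply: sub_bimodule_sum bM _ => h _.
  have [Jp Mq ->] := pq (gcomp (ginv h) k).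
  by rewrite nmulDr addrAC subrr add0r; apply: (bMM _ _ Mq).1.
rewrite -[RHS](skew_oneP.2 X I).1 -trace_sum nmul_suml.
under [RHS]eq_bigr => k _ do rewrite -skew_mulA pX nmul_sumr.
rewrite (exchange_big_dep xpredT) //= {1}(skew_mono X) nmul_suml.
apply: eq_bigr => h _.
rewrite nmul_sumr (bigID (composable h)) /= [X in _ + X]big1; last first.
  move=> g /negPf nhg.
  by rewrite skew_mulA mono_mul nhg nmul0r.
(* With [g] replaced by [gcomp (ginv h) k], the left factors on both sides become
   [mono k (val X h)]. *)
rewrite addr0 (reindex_onto (gcomp (ginv h)) (gcomp h)) /=; last first.
  by move=> g; apply: gcompKV.
have comp k : gcod k = gcod h ->
    composable (ginv h) k /\ gcomp h (gcomp (ginv h) k) = k.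
  move=> kh; have hk : composable (ginv h) k by rewrite /composable gdom_inv kh.
  by split=> //; have := gcompKV hk; rewrite ginvK.
apply: eq_big => [k|k /andP[hk /eqP hhk]].
  apply/andP/eqP => [[hk /eqP <-]|/esym/comp[hk ->]].
    by rewrite gcod_comp //; apply/eqP.
  by split=> //; rewrite /composable gcod_comp ?gcod_inv //; apply/eqP.
rewrite !skew_mulA mono_mul hk hhk mono_diag gactKV.
rewrite gact_rone rone_mul mono_gone mul_gone //; exact: skew_val_in.
Qed.
End Averaging.

(** * Complements of sub-bimodules *)

Section Complement.
Variables (n : nat) (b : 'I_n -> R).
Hypothesis blockP : is_blocks rone b.

(** The sum of the components indexed by [K], given by vanishing conditions so that membership
    requires no decomposition. *)
Definition block_span (K : {set G * 'I_n}) : set S :=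
  [set X : S | forall g i, (g, i) \notin K -> b i ** val X g = 0].
Local Notation M := block_span.

Lemma block_bimodule (K : {set G * 'I_n}) : sub_bimodule (M K).
Proof.
have [_ bC _ _] := blockP.
split=> [g i _|X Y MX MY g i Kgi|r X MX].
- by rewrite val_0 nmulr0.
- by rewrite val_add nmulDr MX // MY // addr0.
- split=> g i Kgi; rewrite ?val_diagl ?val_diagr.
    by rewrite mulA bC -mulA MX // nmulr0.
  by rewrite mulA MX // nmul0r.
Qed.

(** Take [K] maximal among the sets whose span meets [N] trivially. By simplicity, every component
    outside [K] then lies in [N + M K]. Starting from [K0] allows nested complements. *)
Lemma block_complement (N : set S) (K0 : {set G * 'I_n}) :
  sub_bimodule N -> (forall X, N X -> M K0 X -> X = 0) ->
  exists K : {set G * 'I_n}, [/\ K0 \subset K, forall X, N X -> M K X -> X = 0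
    & forall X, exists Y Z, [/\ N Y, M K Z & X = Y + Z]].
Proof.
move=> bN NM0; have [sumb bC bb simpleb] := blockP.
pose indep (K : {set G * 'I_n}) := `[< forall X, N X -> M K X -> X = 0 >].
have [K /maxsetP[/asboolP NK maxK] K0K] :=
  maxset_exists (asboolT NM0 : indep K0).
exists K; split=> //.
pose NM := [set X | exists Y Z, [/\ N Y, M K Z & X = Y + Z]].
have [N0 ND NMul] := bN; have bMK := block_bimodule K.
have [M0 MD MMul] := bMK.
have bNM : sub_bimodule NM.
  split.
  - by exists 0, 0; rewrite addr0.
  - move=> _ _ [Y [Z [NY MZ ->]]] [Y' [Z' [NY' MZ' ->]]].
    exists (Y + Y'), (Z + Z'); rewrite addrACA.
    by split; [apply: ND | apply: MD |].
  - move=> r _ [Y [Z [NY MZ ->]]]; rewrite nmulDl nmulDr.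
    split.
      exists (diag r ** Y), (diag r ** Z).
      by split=> //; [apply: (NMul r Y NY).1 | apply: (MMul r Z MZ).1].
    exists (Y ** diag r), (Z ** diag r).
    by split=> //; [apply: (NMul r Y NY).2 | apply: (MMul r Z MZ).2].
have NM_N X : N X -> NM X by move=> NX; exists X, 0; rewrite addr0.
have NM_M X : M K X -> NM X by move=> MX; exists 0, X; rewrite add0r.
have NMgi g i r : NM (mono g (b i ** r)).
  have [Kgi|nKgi] := boolP ((g, i) \in K).
    apply: NM_M => h j Khj; rewrite val_mono; case: eqP => [hg|_]; last first.
      exact: nmulr0.
    have ji : j != i by apply: contraNneq Khj => ->; rewrite hg.
    rewrite mulA -(gone_comm g) -mulA (mulA (b j)) bb (negPf ji).
    by rewrite nmul0r nmulr0.
  (* By maximality the enlarged span contains a non-zero [X] of [N]. Its component [z] at [(g, i)]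
     is non-zero, as otherwise [X] would lie in [M K]. *)
  pose K' := (g, i) |: K.
  have KK' : K \subset K' by apply: finset.subsetU1.
  have /asboolPn/existsNP[X /not_implyP[NX /not_implyP[MX /eqP X0]]] :
      ~~ indep K'.
    apply: contra nKgi => indK'; rewrite -(maxK K') //; exact: finset.setU11.
  pose z := b i ** val X g.
  have Dz : gone g ** z = z.
    rewrite gone_mul //; apply: ideal_mull (pideal_ideal_of_ring _) _.
    exact: skew_val_in.
  have MXz : M K (X - mono g z).
    move=> h j Khj; rewrite val_sub val_mono nmulBr.
    have [E|ne] := eqVneq (h, j) (g, i).
      by case: E => -> ->; rewrite eqxx Dz /z mulA bb eqxx subrr.
    rewrite MX ?finset.in_setU1 ?negb_or ?ne // sub0r.
    have [hg|_] := eqVneq h g; last by rewrite nmulr0 oppr0.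
    have ji : j != i by apply: contraNneq ne => ->; rewrite hg.
    by rewrite Dz mulA bb (negPf ji) nmul0r oppr0.
  have z0 : z != 0.
    apply/eqP => z0; case/eqP: X0; apply: NK => //.
    by have := MXz; rewrite z0 mono0 subr0.
  have NMz : NM (mono g z).
    have -> : mono g z = X - (X - mono g z) by rewrite subKr.
    have [_ NMD _] := bNM; apply: NMD; first exact: NM_N.
    exact/(sub_bimoduleN bNM)/NM_M.
  (* An ideal of the simple block containing [z], hence the whole block. Right multiplication by [s]
     is realised by [diag (gact (ginv g) s)]. *)
  pose W := [set s | b i ** s = s /\ NM (mono g s)].
  have [] := simpleb i W.
  - have [NM0' NMD NMmul] := bNM.
    split=> [s []//||s s' [bs Ws] [bs' Ws']|s s' bs [bs' Ws']].
    + by split; rewrite ?nmulr0 ?mono0.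
    + split; first by rewrite nmulBr bs bs'.
      by rewrite monoB; apply: NMD => //; apply: sub_bimoduleN.
    + split; split; rewrite ?mulA ?bs ?bs' //.
        by rewrite -diag_mono; apply: (NMmul _ _ Ws').1.
      have -> : mono g (s' ** s) = mono g s' ** diag (gact (ginv g) s).
        by rewrite mono_diag gactKV mulA -gone_comm -mulA mono_gone.
      exact: (NMmul _ _ Ws').2.
  - move=> W0; have : W z by split=> //; rewrite /z mulA bb eqxx.
    by rewrite W0 => /eqP; rewrite (negPf z0).
  - move=> Wb; have : W (b i ** r) by rewrite Wb /= mulA bb eqxx.
    by case.
move=> X; suff [Y [Z]] : NM X by exists Y, Z.
rewrite (skew_mono X); apply: (@sub_bimodule_sum NM _ _ _ _ bNM) => g _.
rewrite -[val X g]rone_mul -sumb nmul_suml mono_sum.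
by apply: (@sub_bimodule_sum NM _ _ _ _ bNM) => i _.
Qed.

(* A descending chain of ideals has a strictly ascending chain of
   complements M K, and K ranges over subsets of a finite set. *)
Lemma semisimple_of_trace_one eps :
  (forall r, eps ** r = r ** eps) -> \sum_g gact g eps = rone ->
  semisimple_ring S.
Proof.
move=> epsC eps_trace; have [sumb _ _ _] := blockP.
pose len (J : set S) m := exists K : {set G * 'I_n},
  [/\ m = #|~: K|%SET, forall X, J X -> M K X -> X = 0
    & forall X, exists Y Z, [/\ J Y, M K Z & X = Y + Z]].
have MT0 X : M finset.set0 X -> X = 0.
  move=> MX; apply: skewP => g.
  rewrite val_0 -[val X g]rone_mul -sumb nmul_suml.
  by apply: big1 => i _; rewrite MX ?finset.in_set0.
apply: (@semisimple_of_length S _ skew_mulA skew_oneP len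
  _ _ #|~: finset.set0 : {set G * 'I_n}|%SET).
- apply: right_identity_identity => //; first exact: skew_mulA.
  move=> J idJ; have bJ := ideal_sub_bimodule idJ.
  have [|K [_ JM0 JM]] := @block_complement J finset.set0 bJ.
    by move=> X _ /MT0.
  exact: (right_identity_of_complement epsC eps_trace idJ (block_bimodule K)).
- move=> J J' _ idJ idJ' JJ' nJJ' [K [-> JM0 JM]].
  have bJ := ideal_sub_bimodule idJ; have bJ' := ideal_sub_bimodule idJ'.
  have [|K' [KK' J'M0 J'M]] := @block_complement J K bJ.
    by move=> X /JJ'; apply: JM0.
  exists #|~: K'|%SET; last by exists K'.
  apply: proper_card; rewrite finset.properEneq finset.setCS KK' andbT.
  (* If [K' = K], the part [Z] of [X] lies in both [J'] and [M K], so it is zero and [X] belongs to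
     [J]. *)
  apply/eqP => /finset.setC_inj E; apply: nJJ'; apply/seteqP; split=> // X J'X.
  have [Y [Z [JY MZ XE]]] := J'M X.
  suff Z0 : Z = 0 by rewrite XE Z0 addr0.
  apply: JM0; last by rewrite -E.
  have -> : Z = X - Y by rewrite XE addrC addKr.
  by apply: (ideal_sub idJ') => //; apply: JJ'.
- exists finset.set0; split=> // [X _ /MT0//|X].
  by exists X, 0; rewrite addr0; split=> // g i _; rewrite val_0 nmulr0.
Qed.
End Complement.
End UnitalAction.

(** * Central idempotents of a semisimple ring *)

(** The component of the identity in a summand is the identity of that summand. *)
Lemma semisimple_blocks (R : naRingType) (one : R) :
  associative (@nmul R) -> is_identity setT one -> semisimple_ring R ->
  exists n (b : 'I_n -> R), is_blocks one b.
Proof.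
move=> mulA [_ oneP] [n [A [idA simpleA [decomp uniq]]]].
have disj i j r : i != j -> A i r -> A j r -> r = 0.
  move=> ij Ai Aj.
  pose x k := if k == i then r else if k == j then - r else 0.
  have := uniq x _ _ i isT; rewrite /x eqxx; apply=> [k _|].
    case: eqP => [->//|_]; case: eqP => [->|_].
      exact: ideal_opp (idA j) Aj.
    by case: (idA k).
  rewrite (bigD1 i) // (bigD1 j) /=; last by rewrite eq_sym.
  rewrite !eqxx [j == i]eq_sym (negPf ij) big1 ?addr0 ?subrr // => k.
  by move=> /andP[/negPf -> /negPf ->].
have [b [Ab oneE]] := decomp one.
have bA i : is_identity (A i) (b i).
  split=> [|x Ax]; first exact: Ab.
  have [] := oneP x I; rewrite oneE nmul_suml nmul_sumr.
  rewrite (bigD1 i) //= big1 => [|j ji]; last first.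
    apply: (disj j i) => //; first exact: ideal_mulr (idA j) (Ab j isT).
    exact: ideal_mull (idA i) Ax.
  rewrite addr0 => bx; rewrite (bigD1 i) //= big1 => [|j ji]; last first.
    apply: (disj j i) => //; first exact: ideal_mull (idA j) (Ab j isT).
    exact: ideal_mulr (idA i) Ax.
  by rewrite addr0.
have AE i : [set r | b i ** r = r] = A i.
  by apply/seteqP; split=> r /(identity_memP r (idA i) (bA i)).
exists n, b; split=> // [i r|i j|i J].
- exact: (identity_comm mulA r (idA i) (bA i)).
- have [<-|ij] := eqVneq i j; first by have [] := (bA i).2 _ (Ab i isT).
  apply: (disj i j) => //; first exact: ideal_mulr (idA i) (Ab i isT).
  exact: ideal_mull (idA j) (Ab j isT).
- by rewrite AE => /simpleA.
Qed.

(** * Subgroups of isotropy groups *)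

(** Lagrange's theorem: the left cosets of [H] partition the isotropy group, and each is in
    bijection with [H]. *)
Lemma card_subgroup_dvdn (G : finGroupoid) (e : G) (H : {set G}) :
  e \in H -> {in H, forall h, isotropy e h} ->
  {in H &, forall g h, gcomp g h \in H} -> {in H, forall h, ginv h \in H} ->
  (#|H| %| #|isotropy e|)%N.
Proof.
move=> He Hiso HM HV.
pose coset g := [set gcomp g h | h in H]%SET.
have isoP g : isotropy e g -> gdom g = e /\ gcod g = e.
  by move=> /andP[/eqP-> /eqP->].
have coset_refl g : isotropy e g -> g \in coset g.
  move=> /isoP[ge _]; apply/finset.imsetP; exists e => //.
  by rewrite -ge gcomp_dom.
have coset_sub g h : isotropy e g -> h \in H ->
    coset (gcomp g h) \subset coset g.
  move=> /isoP[ge _] Hh; apply/fintype.subsetP => _ /finset.imsetP[k Hk ->].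
  have [he he'] := isoP _ (Hiso h Hh); have [_ ke] := isoP _ (Hiso k Hk).
  rewrite -gcompA ?ge ?he ?he' ?ke //.
  by apply/finset.imsetP; exists (gcomp h k) => //; apply: HM.
have coset_eq g k : isotropy e g -> k \in coset g -> coset k = coset g.
  move=> isog /finset.imsetP[h Hh ->]; apply/eqP.
  rewrite finset.eqEsubset coset_sub //=.
  have [ge ge'] := isoP _ isog; have [he he'] := isoP _ (Hiso h Hh).
  have {1}-> : g = gcomp (gcomp g h) (ginv h).
    by rewrite -gcompA ?gcod_inv ?ge ?he' // gcompV he' -ge gcomp_dom.
  apply: coset_sub; last exact: HV.
  by rewrite /isotropy /= gdom_comp ?gcod_comp ?ge ?he' // ge' he eqxx.
have card_coset g : isotropy e g -> #|coset g| = #|H|.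
  move=> /isoP[ge _]; apply: card_in_imset => h k Hh Hk E.
  have [_ he] := isoP _ (Hiso h Hh); have [_ ke] := isoP _ (Hiso k Hk).
  by rewrite -(@gcompKV _ g h) ?E ?gcompKV // /composable ge ?he ?ke.
rewrite -[#|isotropy e|]sum1_card (partition_big_imset coset) /=.
apply: dvdn_sum => C /finset.imsetP[g isog ->].
suff fiber : [pred k | (k \in isotropy e) && (coset k == coset g)] =i coset g.
  by rewrite sum1_card (eq_card fiber) card_coset.
move=> k; apply/andP/idP => [[isok /eqP <-]|gk]; first exact: coset_refl.
split; last by rewrite (coset_eq g k).
have [ge ge'] := isoP _ isog; have /finset.imsetP[h Hh ->] := gk.
have [he he'] := isoP _ (Hiso h Hh).
by rewrite inE gdom_comp ?gcod_comp ?ge ?he ?he' ?ge' ?eqxx.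
Qed.

(** * The action on the blocks *)

Section TraceOne.
Variables (R : naRingType) (G : finGroupoid) (alpha : partial_action G R).
Hypothesis mulA : associative (@nmul R).
Hypothesis unital : unital_action alpha.
Variables (n : nat) (b : 'I_n -> R).
Hypothesis blockP : is_blocks (rone alpha) b.
Local Notation gact := (gact alpha).
Local Notation gone := (gone alpha).
Local Notation rone := (rone alpha).
Implicit Types (g h e : G) (i j k : 'I_n) (r s z : R).

Let sumb : \sum_i b i = rone. Proof. by case: blockP. Qed.
Let bC i r : b i ** r = r ** b i. Proof. by case: blockP. Qed.
Let bb i j : b i ** b j = if i == j then b i else 0.
Proof. by case: blockP. Qed.
Let b_idem i : b i ** b i = b i. Proof. by rewrite bb eqxx. Qed.

Lemma block_inj i j : b i != 0 -> b i = b j -> i = j.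
Proof.
move=> bi0 bij; apply: contraNeq bi0 => /negPf ij.
by rewrite -(b_idem i) {2}bij bb ij.
Qed.

(** The elements of the simple block fixed by [z] form an ideal of it. *)
Lemma central_idempotent_block i z : (forall r, z ** r = r ** z) ->
  z ** z = z -> b i ** z = z -> z = 0 \/ z = b i.
Proof.
move=> zC zz bz; have [_ _ _ simpleb] := blockP.
pose J := [set r | b i ** r = r /\ z ** r = r].
have [] := simpleb i J.
- split=> [r []//||r s [br zr] [bs zs]|r s br [bs zs]].
  + by split; rewrite nmulr0.
  + by split; rewrite nmulBr ?br ?bs ?zr ?zs.
  + by split; split; rewrite ?mulA ?br ?bs ?zs // zC -mulA zs.
- by move=> J0; left; have : J z by []; rewrite J0.
- move=> JE; right; have [_ <-] : J (b i) by rewrite JE /= b_idem.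
  by rewrite -bC bz.
Qed.

Lemma gone_block g i : gone g ** b i = 0 \/ gone g ** b i = b i.
Proof.
have goneC := gone_comm mulA unital g.
apply: central_idempotent_block => [r||].
- by rewrite -mulA bC mulA goneC -mulA.
- by rewrite -mulA (mulA (b i)) -goneC -mulA b_idem mulA gone_idem.
- by rewrite mulA -goneC -mulA b_idem.
Qed.

(** Only [gone g ** r] matters, and it is the image under [gact g] of an element commuting with
    [z]. *)
Lemma gact_central g z : (forall r, z ** r = r ** z) ->
  forall r, gact g z ** r = r ** gact g z.
Proof.
move=> zC r.
rewrite -{1}(gact_gone mulA unital g z) -mulA -(gactKV mulA unital g r).
by rewrite -gactM // zC gactM // gactKV // gone_comm // -mulA gone_gact.
Qed.

(** The image [w] is a central idempotent, so it contains some non-zero [b j]. Pulled back, [b j] is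
    a non-zero central idempotent of block [i], hence [b i] itself. *)
Lemma gact_block g i : gact g (b i) != 0 ->
  exists2 j, b j != 0 & gact g (b i) = b j.
Proof.
set w := gact g (b i) => w0.
have wC : forall r, w ** r = r ** w by apply: gact_central.
have ww : w ** w = w by rewrite -gactM // b_idem.
have [j bw0] : exists j, b j ** w != 0.
  apply/existsP; apply: contraNT w0 => /existsPn bw0.
  rewrite -[w](rone_mul mulA unital) -sumb nmul_suml big1 // => j _.
  by have := bw0 j; rewrite negbK => /eqP.
have bw : b j ** w = b j.
  have [|||/eqP|//] := @central_idempotent_block j (b j ** w).
  - by move=> r; rewrite -mulA wC mulA bC -mulA.
  - by rewrite -mulA (mulA w) wC -mulA ww mulA b_idem.
  - by rewrite mulA b_idem.
  - by rewrite (negPf bw0).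
exists j; first by rewrite -bw.
set v := gact (ginv g) (b j).
have gv : gact g v = gone g ** b j by rewrite gactKV.
have bv : v ** b i = v.
  rewrite -[in RHS]/v /v -{2}bw gactM // gactK // mulA.
  by rewrite gact_gone.
have bu : b j ** gone g = b j by rewrite -{1}bw -mulA gact_gone.
have [|||v0|vb] := @central_idempotent_block i v.
- exact: gact_central.
- by rewrite -gactM // b_idem.
- by rewrite bC.
- by move: bw0; rewrite bw -bu -gone_comm // -gv v0 gact0 // eqxx.
- by rewrite /w -vb gv gone_comm.
Qed.

(** Zero blocks are excluded: every [g] would send each of them to all the others. *)
Definition moves g i j := (b j != 0) && (gact g (b i) == b j).

Lemma movesV g i j : moves g i j -> moves (ginv g) j i.
Proof.
move=> /andP[bj0 /eqP gb].
have bi0 : b i != 0 by apply: contraNneq bj0 => bi0; rewrite -gb bi0 gact0.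
rewrite /moves bi0 -gb gactK //.
have [u0|->] := gone_block (ginv g) i; last exact: eqxx.
by move: bj0; rewrite -gb -gact_gone_mul // u0 gact0 // eqxx.
Qed.

(** Without composability the composite would be zero. The idempotent [gone g] from [gact_comp]
    fixes or kills the image block, and the second case would give [b k = 0]. *)
Lemma moves_comp g h i j k : moves h i j -> moves g j k ->
  composable g h /\ moves (gcomp g h) i k.
Proof.
move=> /andP[bj0 /eqP hb] /andP[bk0 /eqP gb].
have gh : composable g h.
  by apply: contraNT bk0 => ngh; rewrite -gb -hb gact_comp0.
split=> //; rewrite /moves bk0 /=.
have := gb; rewrite -hb gact_comp // => E.
have [|l bl0 El] := @gact_block (gcomp g h) i.
  by apply: contraNneq bk0 => E0; rewrite -E E0 nmulr0.
rewrite El -E El; have [u0|->] := gone_block g l; last exact: eqxx.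
by move: bk0; rewrite -E El u0 eqxx.
Qed.

Lemma moves_fun g i j k : moves g i j -> moves g i k -> j = k.
Proof.
move=> /andP[bj0 /eqP gj] /andP[_ /eqP gk].
by apply: block_inj => //; rewrite -gj.
Qed.

Lemma moves_ob i : b i != 0 -> exists2 e, is_ob e & moves e i i.
Proof.
move=> bi0.
have [e /andP[obe ub]] : exists e, is_ob e && (gone e ** b i != 0).
  apply/existsP; apply: contraNT bi0 => /existsPn ub0.
  rewrite -[b i](rone_mul mulA unital) nmul_suml big1 // => e obe.
  by have := ub0 e; rewrite obe negbK => /eqP.
exists e => //; rewrite /moves bi0 gact_ob //.
have [u0|->] := gone_block e i; last exact: eqxx.
by rewrite u0 eqxx in ub.
Qed.

(** Since [e] also stabilizes the block, [moves_comp] makes [g] composable with [e] on both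
    sides. *)
Lemma moves_id i g : moves g i i -> forall e, is_ob e -> moves e i i ->
  isotropy e g.
Proof.
move=> gi e obe ei.
have [/eqP ge _] := moves_comp ei gi; have [/eqP eg _] := moves_comp gi ei.
by rewrite /isotropy /= ge ob_cod // -eg (eqP obe) eqxx.
Qed.

Definition transporter i j : {set G} := [set g | moves g i j]%SET.

(** Left composition with [f] is injective on the transporter. *)
Lemma leq_transporter f i j k : moves f j k ->
  (#|transporter i j| <= #|transporter i k|)%N.
Proof.
move=> fjk; rewrite -(@card_in_imset _ _ (gcomp f) (transporter i j)).
  apply/subset_leq_card/fintype.subsetP => _ /finset.imsetP[g + ->].
  by rewrite !inE => gij; have [] := moves_comp gij fjk.
move=> g h; rewrite !inE => gij hij E.
have [fg _] := moves_comp gij fjk; have [fh _] := moves_comp hij fjk.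
by rewrite -(gcompKV fg) E gcompKV.
Qed.

Lemma eq_transporter f i j k : moves f j k ->
  #|transporter i j| = #|transporter i k|.
Proof.
move=> fjk; apply/eqP; rewrite eqn_leq (leq_transporter i fjk).
exact: leq_transporter (movesV fjk).
Qed.

Lemma card_transporterC i j : #|transporter i j| = #|transporter j i|.
Proof.
suff le k l : (#|transporter k l| <= #|transporter l k|)%N.
  by apply/eqP; rewrite eqn_leq !le.
rewrite -(card_imset _ (can_inj (@ginvK G))).
apply/subset_leq_card/fintype.subsetP => _ /finset.imsetP[g + ->].
by rewrite !inE; apply: movesV.
Qed.

Lemma card_transporter f i j : moves f i j ->
  #|transporter i j| = #|transporter j j| /\
  #|transporter i i| = #|transporter j j|.
Proof.
move=> fij; have E := eq_transporter i fij.
have E' : #|transporter j j| = #|transporter j i|.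
  exact: eq_transporter (movesV fij).
by split; rewrite ?E E' card_transporterC.
Qed.

Lemma card_stabilizer_dvdn i e : is_ob e -> moves e i i ->
  (#|transporter i i| %| #|isotropy e|)%N.
Proof.
move=> obe ei; apply: card_subgroup_dvdn => [|g|g h|g].
- by rewrite inE.
- by rewrite inE => /moves_id; apply.
- by rewrite !inE => gi hi; have [] := moves_comp hi gi.
- by rewrite !inE; apply: movesV.
Qed.

(** * A central element of trace one *)

Hypothesis invertible_isotropy :
  forall e : G, is_ob e -> nat_invertible R #|isotropy e|.

Definition rnat_inv m : R := xget 0 [set c | c *+ m = rone].

Lemma rnat_invP i : b i != 0 ->
  rnat_inv #|transporter i i| *+ #|transporter i i| = rone.
Proof.
move=> /moves_ob[e obe ei]; have /dvdnP[q isoE] := card_stabilizer_dvdn obe ei.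
have [u [v [[_ uP] uv _]]] := invertible_isotropy obe.
have uE : u = rone.
  by have [<- _] := uP rone I; rewrite mul_rone.
(* The isotropy order is [q] times the stabilizer order, so [q] times its inverse [v] inverts the
   latter. *)
apply: (@xgetPex _ _ [set c | c *+ _ = rone]); exists (v *+ q).
by rewrite /= -mulrnA -isoE -uE -[RHS]uv nmulMnl uE rone_mul.
Qed.

Lemma rnat_inv_comm i r : b i != 0 ->
  rnat_inv #|transporter i i| ** r = r ** rnat_inv #|transporter i i|.
Proof.
move=> /rnat_invP; set c := rnat_inv _; set m := #|_| => cm.
rewrite -[LHS](mul_rone mulA unital) -cm nmulMnr -nmulMnl -nmulMnl cm.
by rewrite rone_mul.
Qed.

Definition bdiv i : R := rnat_inv #|transporter i i| ** b i.

Lemma bdivMn i : b i != 0 -> bdiv i *+ #|transporter i i| = b i.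
Proof. by move=> bi0; rewrite /bdiv -nmulMnl rnat_invP // rone_mul. Qed.

Lemma bdiv_comm i r : b i != 0 -> bdiv i ** r = r ** bdiv i.
Proof.
by move=> bi0; rewrite /bdiv -mulA bC mulA rnat_inv_comm // -mulA.
Qed.

(** The sum has at most one term, and none if [g] kills the block. The denominators agree because
    blocks in one orbit have stabilizers of equal order. *)
Lemma gact_bdiv g i : b i != 0 ->
  gact g (bdiv i) = \sum_(j | moves g i j) bdiv j.
Proof.
move=> bi0; rewrite /bdiv gactM //.
have [gb0|/gact_block[j bj0 gb]] := eqVneq (gact g (b i)) 0.
  by rewrite gb0 nmulr0 big1 // => j /andP[bj0]; rewrite gb0 eq_sym (negPf bj0).
have gij : moves g i j by rewrite /moves bj0 gb eqxx.
rewrite (bigD1 j) //= big1 ?addr0 => [|k /andP[gik /eqP []]]; last first.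
  exact: moves_fun gik gij.
have [_ nij] := card_transporter gij.
rewrite gb nij; set m := #|_|; set c := rnat_inv m.
have cm : c *+ m = rone by apply: rnat_invP.
rewrite -[LHS](mul_rone mulA unital) -cm nmulMnr -nmulMnl -nmulMnl.
rewrite -gactMn // cm gact_rone // -gb gone_gact //.
by rewrite rnat_inv_comm.
Qed.

(** The default [j] is reached only for zero blocks. *)
Definition orbit_rep j := odflt j [pick i | [exists g, moves g i j]].

Lemma moves_orbit_rep j : b j != 0 -> exists g, moves g (orbit_rep j) j.
Proof.
move=> /moves_ob[e _ ej]; rewrite /orbit_rep; case: pickP => [i /existsP//|].
by move=> /(_ j)/existsP[]; exists e.
Qed.

Lemma eq_orbit_rep g i j : moves g i j -> orbit_rep i = orbit_rep j.
Proof.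
move=> gij; rewrite /orbit_rep.
have E :
    (fun k => [exists h, moves h k i]) =1 (fun k => [exists h, moves h k j]).
  move=> k; apply/existsP/existsP => -[h].
    by move=> hki; exists (gcomp g h); have [] := moves_comp hki gij.
  move=> hkj; exists (gcomp (ginv g) h).
  by have [] := moves_comp hkj (movesV gij).
rewrite (eq_pick E); case: pickP => // /(_ i)/existsP[]; by exists g.
Qed.

(** In the trace, [bdiv j] occurs once for each [g] carrying the representative of its orbit to [j].
    Their number is the order of the stabilizer of [j], so these terms add up to [b j]. *)
Lemma trace_one : exists2 eps, forall r, eps ** r = r ** eps &
  \sum_g gact g eps = rone.
Proof.
pose P i := (b i != 0) && (orbit_rep i == i).
exists (\sum_(i | P i) bdiv i).
  move=> r; rewrite nmul_suml nmul_sumr; apply: eq_bigr => i /andP[bi0 _].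
  exact: bdiv_comm.
transitivity (\sum_g \sum_(i | P i) \sum_j if moves g i j then bdiv j else 0).
  apply: eq_bigr => g _; rewrite gact_sum //; apply: eq_bigr => i /andP[bi0 _].
  by rewrite gact_bdiv // big_mkcond.
rewrite exchange_big /=.
under eq_bigr => i _ do rewrite exchange_big /=.
rewrite exchange_big -sumb /=; apply: eq_bigr => j _.
have [bj0|bj0] := eqVneq (b j) 0.
  rewrite bj0 big1 // => i _; rewrite big1 // => g _.
  by rewrite /moves bj0 eqxx.
have [g grj] := moves_orbit_rep bj0.
have rr := eq_orbit_rep grj.
have [br0 _] := andP (movesV grj).
rewrite (bigD1 (orbit_rep j)) /=; last by rewrite /P br0 rr eqxx.
have [E _] := card_transporter grj.
rewrite -big_mkcond sumr_const big1 => [|i /andP[/andP[_ /eqP ri] ne]].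
  rewrite addr0 -[RHS]bdivMn // -E; congr (_ *+ _).
  by apply: eq_card => h; rewrite !inE.
(* Another representative carried to [j] would equal [orbit_rep j]. *)
rewrite big1 // => h _; case: ifP => // hij.
by move: ne; rewrite -ri (eq_orbit_rep hij) eqxx.
Qed.
End TraceOne.

Theorem theorem6p11 (R : naRingType) (G : finGroupoid)
    (alpha : partial_action G R) :
  associative (@nmul R) ->
  unital_action alpha ->
  semisimple_ring R ->
  (forall e : G, is_ob e -> nat_invertible R #|isotropy e|) ->
  semisimple_ring (skew_ring alpha).
Proof.
move=> mulA unital ssR invR.
have [n [b blockP]] := semisimple_blocks mulA (roneP mulA unital) ssR.
have [eps epsC eps_trace] := trace_one mulA unital blockP invR.
exact: (semisimple_of_trace_one mulA unital blockP epsC eps_trace).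
Qed.
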